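(* There exist bounded big Hankel operators $\Gamma:H^2(\mathbb T^2)\to H^2(\mathbb T^2)^\perp$ for which there is no $\varphi\in L^\infty(\mathbb T^2)$ with $\Gamma=\Gamma_\varphi$.
   Context: $\mathbb T=\mathbb R/2\pi\mathbb Z$ carries normalized Lebesgue measure. $H^2(\mathbb T^2)=\{f\in L^2(\mathbb T^2):\hat f(m,n)=0 \text{ unless } m,n\ge0\}$, $P$ is the orthogonal projection of $L^2$ onto $H^2(\mathbb T^2)$, and $H^2(\mathbb T^2)^\perp=L^2\ominus H^2(\mathbb T^2)$. A big Hankel operator is a linear map $\Gamma$ from the analytic trigonometric polynomials into $H^2(\mathbb T^2)^\perp$ satisfying $\Gamma(S_kf)=(I-P)(S_k\Gamma f)$ for $k=1,2$, where $S_1f=e^{ix}f$ and $S_2f=e^{iy}f$. Equivalently, $\Gamma=\Gamma_\phi$ for some $\phi\in L^2(\mathbb T^2)$, where $\Gamma_\phi f=(I-P)(\phi f)$; such a $\phi$ is called a symbol of $\Gamma$. The operator $\Gamma$ is bounded if $\sup\|\Gamma f\|_2/\|f\|_2<\infty$, in which case it extends to $H^2(\mathbb T^2)$. *)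

(* Defs.v *)
(* Functions on T^2 are functions on R*R restricted
   to the fundamental domain D = [0,2pi) x [0,2pi), with the normalized product
   Lebesgue measure; complex values are taken in R[i] (mathcomp-real-closed). *)
From HB Require Import structures.
From mathcomp Require Import all_boot all_order all_algebra.
From mathcomp Require Import all_classical all_reals all_analysis.
From mathcomp Require Import complex.
Import Order.TTheory GRing.Theory Num.Theory.
Set Implicit Arguments. Unset Strict Implicit. Unset Printing Implicit Defensive.
Local Open Scope ring_scope.
Local Open Scope classical_set_scope.

Section BigHankel.
Variable R : realType.

Definition mu2 := ((@lebesgue_measure R) \x (@lebesgue_measure R))%E.

Definition T2dom : set (R * R) := `[0, 2 * pi[%classic `*` `[0, 2 * pi[%classic.

Definition cnorm2 (w : R[i]) : R := complex.Re w ^+ 2 + complex.Im w ^+ 2.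
Definition cabs (w : R[i]) : R := Num.sqrt (cnorm2 w).

Definition cexp (m n : int) (z : R * R) : R[i] :=
  Complex (cos (m%:~R * z.1 + n%:~R * z.2)) (sin (m%:~R * z.1 + n%:~R * z.2)).

Definition avg (g : R * R -> R[i]) : R[i] :=
  Complex (Rintegral mu2 T2dom (fun z => complex.Re (g z)) / (4 * pi ^+ 2))
    (Rintegral mu2 T2dom (fun z => complex.Im (g z)) / (4 * pi ^+ 2)).

Definition fcoef (g : R * R -> R[i]) (m n : int) : R[i] :=
  avg (fun z => g z * cexp (- m) (- n) z).

Definition L2norm2 (g : R * R -> R[i]) : R :=
  Rintegral mu2 T2dom (fun z => cnorm2 (g z)) / (4 * pi ^+ 2).

Definition cmeasurable (g : R * R -> R[i]) : Prop :=
  measurable_fun T2dom (fun z => complex.Re (g z)) /\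
  measurable_fun T2dom (fun z => complex.Im (g z)).

Definition inL2 (g : R * R -> R[i]) : Prop :=
  cmeasurable g /\ (\int[mu2]_(z in T2dom) (cnorm2 (g z))%:E < +oo)%E.

Definition inLinf (g : R * R -> R[i]) : Prop :=
  cmeasurable g /\
  exists M : R, {ae mu2, forall z, T2dom z -> cabs (g z) <= M}.

Definition anaPoly (N : nat) (c : nat -> nat -> R[i]) (z : R * R) : R[i] :=
  \sum_(j < N) \sum_(k < N) c j k * cexp j%:Z k%:Z z.

(* (m,n) indexes H^2(T^2)^perp : not (m >= 0 and n >= 0) *)
Definition nonanalytic (m n : int) : bool := (m < 0) || (n < 0).

(* Fourier coefficient at (m,n) of Gamma_phi f = (I-P)(phi f), for nonanalytic (m,n)
   (the coefficients at analytic indices are 0). *)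
Definition hankelCoef (phi : R * R -> R[i]) (N : nat) (c : nat -> nat -> R[i])
    (m n : int) : R[i] :=
  fcoef (fun z => phi z * anaPoly N c z) m n.

(* Gamma_phi is bounded: ||Gamma_phi f||_2^2 <= C ||f||_2^2 for all analytic
   trigonometric polynomials f, where ||Gamma_phi f||_2^2 is the (possibly infinite)
   sum over nonanalytic (m,n) of |coef|^2, expressed via all finite partial sums. *)
Definition bounded_hankel (phi : R * R -> R[i]) : Prop :=
  exists C : R, forall (N : nat) (c : nat -> nat -> R[i]) (S : seq (int * int)),
    uniq S -> all (fun p => nonanalytic p.1 p.2) S ->
    \sum_(p <- S) cnorm2 (hankelCoef phi N c p.1 p.2) <= C * L2norm2 (anaPoly N c).

Definition same_hankel (phi psi : R * R -> R[i]) : Prop :=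
  forall (N : nat) (c : nat -> nat -> R[i]) (m n : int), nonanalytic m n ->
    hankelCoef phi N c m n = hankelCoef psi N c m n.

End BigHankel.

(* Main.v *)
(* Put t = x - y and D_N(t) = sum_(j < N) e^(ijt).  The symbol is
   phi(x, y) = sum_n 4^-n |D_(2^n)(t)|^2, a sum of Fejer kernels that behaves like
   log (1/|t|).  Its Fourier coefficients live on the antidiagonal m + n = 0, where
   they are O(1/|n|).  Hence on each line j + l = m + n the matrix of Gamma_phi is
   dominated by a Hilbert matrix, on the half n < 0 and, symmetrically, on the half
   m < 0; the Schur test bounds it.
   If psi is bounded and Gamma_psi = Gamma_phi, then psi and phi have the same
   coefficients on the antidiagonal except possibly at (0, 0).  Integrating against
   |D_N|^2, whose mean is N, gives at most N sup|psi| for psi, whereas for phi and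
   N = 2^K it gives at least (K - 1) N; this is absurd for large K. *)
Require Import Defs.
From HB Require Import structures.
From mathcomp Require Import all_boot all_order all_algebra.
From mathcomp Require Import all_classical all_reals all_analysis.
From mathcomp Require Import complex.
From mathcomp Require Import measurable_realfun.
From mathcomp Require Import ring lra zify.
Import Order.TTheory GRing.Theory Num.Theory.
Import numFieldNormedType.Exports Normc.
Set Implicit Arguments. Unset Strict Implicit. Unset Printing Implicit Defensive.
Local Open Scope ring_scope.
Local Open Scope classical_set_scope.

(** * Normalized integral over the torus *)

(* [mu2] lives on the product of two copies of [measurableTypeR R], whose display
   differs from that of the sigma-algebra used in [cmeasurable]; the two
   sigma-algebras are convertible. *)
Definition borel2 (R : realType) : measurableType _ :=
  (measurableTypeR R * measurableTypeR R)%type.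

Section TorusMean.
Variable R : realType.
Implicit Types (f g : R * R -> R) (z : R * R).

Local Notation I := (`[0, 2 * pi[%classic : set R).
Local Notation T2 := (@T2dom R).

Definition T2measurable f := @measurable_fun _ _ (borel2 R) R T2 f.

Definition T2integrable f := (@mu2 R).-integrable T2 (EFin \o f).

Definition T2mean f : R := Rintegral (@mu2 R) T2 f / (4 * pi ^+ 2).

Lemma measurable_T2dom : @measurable _ (borel2 R) T2.
Proof. by apply: measurableX; exact: measurable_itv. Qed.

Lemma mu2_T2dom : mu2 T2 = (4 * pi ^+ 2)%:E.
Proof.
rewrite /mu2 /T2dom product_measure1E//.
have muI : (lebesgue_measure I = (2 * pi)%:E)%E.
  by rewrite lebesgue_measure_itv/= lte_fin mulr_gt0 ?pi_gt0// -EFinB subr0.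
transitivity (lebesgue_measure I * lebesgue_measure I)%E; first by [].
by rewrite muI -EFinM; congr EFin; ring.
Qed.

Lemma vol_gt0 : 0 < 4 * pi ^+ 2 :> R.
Proof. by rewrite mulr_gt0// exprn_gt0// pi_gt0. Qed.

Lemma vol_neq0 : 4 * pi ^+ 2 != 0 :> R.
Proof. by rewrite gt_eqF// vol_gt0. Qed.

Lemma mu2_T2dom_lty : (mu2 T2 < +oo)%E.
Proof. by rewrite mu2_T2dom ltry. Qed.

Hint Resolve measurable_T2dom mu2_T2dom_lty : core.

Lemma T2integrable_bounded f (M : R) : T2measurable f ->
  (forall z, `|f z| <= M) -> T2integrable f.
Proof.
move=> mf fM; apply: measurable_bounded_integrable => //.
exists M; split; first exact: num_real.
by move=> x Mx z _; exact: le_trans (fM z) (ltW Mx).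
Qed.

Lemma T2integrableM f g (M : R) : T2measurable f ->
  (forall z, `|f z| <= M) -> T2integrable g -> T2integrable (fun z => f z * g z).
Proof.
move=> mf fM ig; rewrite /T2integrable.
have bf : [bounded f z | z in T2].
  exists M; split; first exact: num_real.
  by move=> x Mx z _; exact: le_trans (fM z) (ltW Mx).
exact: (integrableMr measurable_T2dom mf bf ig).
Qed.

Lemma T2integrable_cst (r : R) : T2integrable (fun=> r).
Proof. by apply: (@T2integrable_bounded _ `|r|) => //; exact: measurable_cst. Qed.

Lemma T2integrableD f g :
  T2integrable f -> T2integrable g -> T2integrable (fun z => f z + g z).
Proof. exact: integrableD. Qed.

Lemma T2integrableZ (r : R) f : T2integrable f -> T2integrable (fun z => r * f z).
Proof. exact: integrableZl. Qed.

Lemma T2integrable_sum (J : Type) (s : seq J) (F : J -> R * R -> R) :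
  (forall i, T2integrable (F i)) -> T2integrable (fun z => \sum_(i <- s) F i z).
Proof.
move=> iF; elim: s => [|i s IHs].
  by under eq_fun do rewrite big_nil; exact: T2integrable_cst.
by under eq_fun do rewrite big_cons; exact: T2integrableD.
Qed.

Lemma T2mean_cst (r : R) : T2mean (fun=> r) = r.
Proof.
rewrite /T2mean Rintegral_cst// [X in fine X](_ : _ = mu2 T2)// mu2_T2dom/=.
by rewrite mulfK// vol_neq0.
Qed.

Lemma T2meanD f g : T2integrable f -> T2integrable g ->
  T2mean (fun z => f z + g z) = T2mean f + T2mean g.
Proof. by move=> f1 g1; rewrite /T2mean (RintegralD measurable_T2dom f1 g1) mulrDl. Qed.

Lemma T2meanZ (r : R) f : T2integrable f ->
  T2mean (fun z => r * f z) = r * T2mean f.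
Proof. by move=> f1; rewrite /T2mean (RintegralZl _ measurable_T2dom f1) -mulrA. Qed.

Lemma T2mean_sum (J : Type) (s : seq J) (F : J -> R * R -> R) :
  (forall i, T2integrable (F i)) ->
  T2mean (fun z => \sum_(i <- s) F i z) = \sum_(i <- s) T2mean (F i).
Proof.
move=> iF; elim: s => [|i s IHs].
  by under eq_fun do rewrite big_nil; rewrite big_nil T2mean_cst.
under eq_fun do rewrite big_cons.
by rewrite big_cons T2meanD ?IHs//; exact: T2integrable_sum.
Qed.

Lemma T2mean_EFin f : T2integrable f ->
  (\int[@mu2 R]_(z in T2) (f z)%:E = (T2mean f * (4 * pi ^+ 2))%:E)%E.
Proof.
move=> f1; rewrite divfK ?vol_neq0// fineK//.
exact: (integrable_fin_num measurable_T2dom f1).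
Qed.

(** The difference agrees almost everywhere with its absolute value, whose integral is nonnegative.
    Writing it [g + -1 * f] lets [T2meanD] and [T2meanZ] apply directly. *)
Lemma le_ae_T2mean f g : T2integrable f -> T2integrable g ->
  {ae (@mu2 R), forall z, T2 z -> f z <= g z} -> T2mean f <= T2mean g.
Proof.
move=> f1 g1 fg.
have gf1 : T2integrable (fun z => g z + -1 * f z).
  by apply: T2integrableD => //; exact: T2integrableZ.
suff : 0 <= T2mean (fun z => g z + -1 * f z).
  by rewrite T2meanD ?T2meanZ ?mulN1r ?subr_ge0//; exact: T2integrableZ.
rewrite divr_ge0 ?(ltW vol_gt0)// /Rintegral fine_ge0//.
have mgf := measurable_int _ gf1.
suff -> : (\int[@mu2 R]_(z in T2) (g z + -1 * f z)%:E =
    \int[@mu2 R]_(z in T2) `|g z + -1 * f z|%:E)%E.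
  by apply: integral_ge0 => z _; rewrite lee_fin.
have mabs := measurable_int _ (integrable_norm gf1).
apply: (ae_eq_integral _ _ measurable_T2dom mgf mabs).
case: fg => N [mN N0 fgN]; exists N; split => //.
apply: subset_trans fgN => z /=; apply: contra_not => fgz Tz.
by rewrite ger0_norm// mulN1r subr_ge0 fgz.
Qed.


(** * Means of sines and cosines *)

Lemma measurable_fun_coord1 : @measurable_fun _ _ (borel2 R) R T2 fst.
Proof. exact: (measurable_funS measurableT (@subsetT _ _) measurable_fst). Qed.

Lemma measurable_fun_coord2 : @measurable_fun _ _ (borel2 R) R T2 snd.
Proof. exact: (measurable_funS measurableT (@subsetT _ _) measurable_snd). Qed.

Lemma T2measurable_cos (a m n : R) :
  T2measurable (fun z => cos (a + (m * z.1 + n * z.2))).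
Proof.
have mcos : measurable_fun [set: R] (@cos R).
  exact: (continuous_measurable_fun (@continuous_cos R)).
apply: (measurableT_comp mcos).
apply: (measurable_funD (measurable_cst a)).
by apply: measurable_funD; apply: measurable_funM => //;
  [exact: measurable_fun_coord1|exact: measurable_fun_coord2].
Qed.

Lemma T2integrable_cos (a m n : R) :
  T2integrable (fun z => cos (a + (m * z.1 + n * z.2))).
Proof.
apply: (@T2integrable_bounded _ 1); first exact: T2measurable_cos.
by move=> z; rewrite ler_norml cos_geN1 cos_le1.
Qed.

Lemma is_derive_sin_affine (a m t : R) :
  is_derive t 1 (fun t => m^-1 * sin (a + m * t)) (m^-1 * (m * cos (a + m * t))).
Proof.
have h : is_derive t 1 (fun t => a + m * t) m.
  have h1 := is_derive_eq (is_deriveZ m (is_derive_id t (1 : R))) (mulr1 m).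
  exact: (is_derive_eq (is_deriveD (is_derive_cst a t (1 : R)) h1) (add0r m)).
have hs : is_derive t 1 (fun t => sin (a + m * t)) (cos (a + m * t) * m).
  exact: (is_derive1_comp (is_derive_sin _) h).
by rewrite (mulrC m); exact: (is_deriveZ m^-1 hs).
Qed.

Lemma sinD2pi_int (a : R) (m : int) : sin (a + m%:~R * (2 * pi)) = sin a.
Proof.
have natP (b : R) (n : nat) : sin (b + n%:R * (2 * pi)) = sin b.
  rewrite (_ : n%:R * (2 * pi) = pi *+ 2 *+ n); last first.
    by rewrite mulr_natl mulr_natl.
  exact: (periodicn (@sinD2pi R)).
case: m => n; first exact: natP.
rewrite NegzE mulrNz mulNr -(natP (a - n.+1%:R * (2 * pi)) n.+1); congr sin.
by rewrite subrK.
Qed.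

(** The antiderivative [m^-1 sin (a + m t)] takes equal values at [0] and [2 pi]. *)
Lemma integral_cos_period (a : R) (m : int) : m != 0 ->
  (\int[@lebesgue_measure R]_(t in I) (cos (a + m%:~R * t))%:E = 0)%E.
Proof.
move=> m0; have mR0 : m%:~R != 0 :> R by rewrite intr_eq0.
have ccos : continuous (fun t : R => cos (a + m%:~R * t)).
  move=> t; apply: (@continuous_comp _ _ _ (fun t : R => a + m%:~R * t) cos).
    by apply: cvgD; [exact: cvg_cst|apply: cvgM; [exact: cvg_cst|exact: cvg_id]].
  exact: continuous_cos.
pose F (t : R) := m%:~R^-1 * sin (a + m%:~R * t).
have dF (t : R) : is_derive t 1 F (cos (a + m%:~R * t)).
  by have := is_derive_sin_affine a m%:~R t; rewrite mulKf.
have cF : continuous F.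
  by move=> t; apply: differentiable_continuous; apply/derivable1_diffP.
rewrite integral_itv_bndo_bndc; last first.
  apply/measurable_EFinP; apply: measurable_funTS.
  exact: continuous_measurable_fun.
rewrite (@continuous_FTC2 _ _ F).
- by rewrite /F sinD2pi_int mulr0 addr0 subee.
- by rewrite mulr_gt0// pi_gt0.
- exact: continuous_subspaceT.
- split=> [t _||].
  + by [].
  + exact/cvg_at_right_filter/cF.
  + exact/cvg_at_left_filter/cF.
- by move=> t _; rewrite derive1E derive_val.
Qed.

(** Fubini is applied on the whole plane to the function cut off outside [T2]; this separates the
    cut-off into one condition per variable. *)
Lemma T2_restrict (F : R * R -> \bar R) x y :
  (F \_ T2) (x, y) = if (x \in I) && (y \in I) then F (x, y) else 0%E.
Proof.
rewrite patchE; case: ifPn => [|/negP] xyT.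
  by have [xI yI] := set_mem xyT; rewrite !mem_set.
case: ifPn => // /andP[xI yI]; exfalso; apply: xyT.
by apply: mem_set; split; exact: set_mem.
Qed.

Lemma T2mean_cos (a : R) (m n : int) :
  T2mean (fun z => cos (a + (m%:~R * z.1 + n%:~R * z.2))) =
  if (m == 0) && (n == 0) then cos a else 0.
Proof.
have [[-> ->]|mn0] : (m = 0 /\ n = 0) \/ (m != 0 \/ n != 0).
  by have [->|m0] := eqVneq m 0; have [->|n0] := eqVneq n 0; auto.
  rewrite eqxx/= -[RHS]T2mean_cst; congr T2mean; apply/funext => z.
  by rewrite !mul0r !addr0.
rewrite ifF; last first.
  by apply/negP => /andP[/eqP m0 /eqP n0]; move: mn0; rewrite m0 n0 eqxx => -[].
set f := fun z : R * R => cos (a + (m%:~R * z.1 + n%:~R * z.2)).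
have f1 : T2integrable f by exact: T2integrable_cos.
have f1r : (@mu2 R).-integrable setT ((EFin \o f) \_ T2).
  by apply/(integrable_mkcond _ measurable_T2dom).
suff f0 : (\int[@mu2 R]_z ((EFin \o f) \_ T2) z = 0)%E.
  by rewrite /T2mean /Rintegral integral_mkcond f0 mul0r.
(* Integrate first in the variable whose frequency is nonzero: the inner integral already
   vanishes. *)
case: mn0 => k0; rewrite /mu2.
  rewrite -(integral21_prod_meas1 f1r) integral0_eq// => y _.
  have [yI|yI] := boolP (y \in I); last first.
    by apply: integral0_eq => x _; rewrite T2_restrict (negbTE yI) andbF.
  rewrite -[RHS](integral_cos_period (a + n%:~R * y) k0) [RHS]integral_mkcond.
  apply: eq_integral => x _; rewrite T2_restrict yI andbT patchE.
  by case: ifP => // _; rewrite /f/= -addrA [n%:~R * y + _]addrC.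
rewrite -(integral12_prod_meas1 f1r) integral0_eq// => x _.
have [xI|xI] := boolP (x \in I); last first.
  by apply: integral0_eq => y _; rewrite T2_restrict (negbTE xI).
rewrite -[RHS](integral_cos_period (a + m%:~R * x) k0) [RHS]integral_mkcond.
apply: eq_integral => y _; rewrite T2_restrict xI/= patchE.
by case: ifP => // _; rewrite /f/= -addrA.
Qed.

Lemma T2mean_sin (m n : int) :
  T2mean (fun z => sin (m%:~R * z.1 + n%:~R * z.2)) = 0.
Proof.
have sinE (x : R) : sin x = cos (- (pi / 2) + x).
  by rewrite cosD cosN sinN cos_pihalf sin_pihalf mul0r mulN1r opprK add0r.
under [X in T2mean X]eq_fun do rewrite sinE.
by rewrite T2mean_cos cosN cos_pihalf if_same.
Qed.

End TorusMean.

(** * Fourier coefficients of trigonometric polynomials *)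

Section ComplexMean.
Variable R : realType.
Implicit Types (g : R * R -> R[i]) (z : R * R) (w : R[i]).

Local Notation CRe := complex.Re.
Local Notation CIm := complex.Im.
Local Notation "x %:C" := (real_complex R x).

Definition Cintegrable g :=
  T2integrable (fun z => CRe (g z)) /\ T2integrable (fun z => CIm (g z)).

Lemma complexReM w1 w2 : CRe (w1 * w2) = CRe w1 * CRe w2 - CIm w1 * CIm w2.
Proof. by case: w1 => a b; case: w2. Qed.

Lemma complexImM w1 w2 : CIm (w1 * w2) = CRe w1 * CIm w2 + CIm w1 * CRe w2.
Proof. by case: w1 => a b; case: w2. Qed.

Lemma complexReD w1 w2 : CRe (w1 + w2) = CRe w1 + CRe w2.
Proof. by case: w1 => a b; case: w2. Qed.

Lemma complexImD w1 w2 : CIm (w1 + w2) = CIm w1 + CIm w2.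
Proof. by case: w1 => a b; case: w2. Qed.

Lemma Cintegrable_cst w : Cintegrable (fun=> w).
Proof. by split; exact: T2integrable_cst. Qed.

Lemma CintegrableD g1 g2 : Cintegrable g1 -> Cintegrable g2 ->
  Cintegrable (fun z => g1 z + g2 z).
Proof.
move=> [r1 i1] [r2 i2]; split.
  by under eq_fun do rewrite complexReD; exact: T2integrableD.
by under eq_fun do rewrite complexImD; exact: T2integrableD.
Qed.

Lemma CintegrableZ w g : Cintegrable g -> Cintegrable (fun z => w * g z).
Proof.
move=> [r i]; split.
  under eq_fun do rewrite complexReM -mulNr.
  by apply: T2integrableD; exact: T2integrableZ.
under eq_fun do rewrite complexImM.
by apply: T2integrableD; exact: T2integrableZ.
Qed.

Lemma Cintegrable_sum (J : Type) (s : seq J) (G : J -> R * R -> R[i]) :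
  (forall i, Cintegrable (G i)) -> Cintegrable (fun z => \sum_(i <- s) G i z).
Proof.
move=> iG; elim: s => [|i s IHs].
  by under eq_fun do rewrite big_nil; exact: Cintegrable_cst.
by under eq_fun do rewrite big_cons; exact: CintegrableD.
Qed.

Lemma avgE g :
  avg g = Complex (T2mean (fun z => CRe (g z))) (T2mean (fun z => CIm (g z))).
Proof. by []. Qed.

Lemma avg_real (f : R * R -> R) : avg (fun z => (f z)%:C) = (T2mean f)%:C.
Proof. by rewrite avgE/= T2mean_cst. Qed.

Lemma avgD g1 g2 : Cintegrable g1 -> Cintegrable g2 ->
  avg (fun z => g1 z + g2 z) = avg g1 + avg g2.
Proof.
move=> [r1 i1] [r2 i2]; rewrite !avgE.
under [X in T2mean X]eq_fun do rewrite complexReD.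
under [X in Complex _ (T2mean X)]eq_fun do rewrite complexImD.
by rewrite !T2meanD.
Qed.

Lemma avgZ w g : Cintegrable g -> avg (fun z => w * g z) = w * avg g.
Proof.
move=> [r i]; rewrite !avgE.
under [X in T2mean X]eq_fun do rewrite complexReM -mulNr.
under [X in Complex _ (T2mean X)]eq_fun do rewrite complexImM.
rewrite !T2meanD ?T2meanZ//; try exact: T2integrableZ.
by apply/eqP; rewrite eq_complex complexReM complexImM/= mulNr !eqxx.
Qed.

Lemma avg_sum (J : Type) (s : seq J) (G : J -> R * R -> R[i]) :
  (forall i, Cintegrable (G i)) ->
  avg (fun z => \sum_(i <- s) G i z) = \sum_(i <- s) avg (G i).
Proof.
move=> iG; elim: s => [|i s IHs].
  under [X in avg X]eq_fun do rewrite big_nil.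
  by rewrite big_nil avgE !T2mean_cst.
under [X in avg X]eq_fun do rewrite big_cons.
by rewrite big_cons avgD ?IHs//; exact: Cintegrable_sum.
Qed.

Lemma cexpD (m n p q : int) z :
  cexp m n z * cexp p q z = cexp (m + p) (n + q) z.
Proof.
apply/eqP; rewrite eq_complex complexReM complexImM/= !rmorphD/=.
set a := m%:~R * _ + _; set b := p%:~R * _ + _.
rewrite (_ : _ * z.1 + _ = a + b); last by rewrite /a /b; ring.
by rewrite (cosD a b) (sinD a b) eqxx/= addrC eqxx.
Qed.

Lemma cexp00 z : cexp 0 0 z = 1.
Proof. by rewrite /cexp !mul0r addr0 cos0 sin0. Qed.

Lemma conj_cexp (m n : int) z : conjc (cexp m n z) = cexp (- m) (- n) z.
Proof. by rewrite /cexp/= !rmorphN/= !mulNr -opprD cosN sinN. Qed.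

Lemma Cintegrable_cexp (m n : int) g : Cintegrable g ->
  Cintegrable (fun z => g z * cexp m n z).
Proof.
pose u z := cos (0 + (m%:~R * z.1 + n%:~R * z.2)) : R.
pose v z := cos (- (pi / 2) + (m%:~R * z.1 + n%:~R * z.2)) : R.
have uE z : CRe (cexp m n z) = u z by rewrite /u add0r.
have vE z : CIm (cexp m n z) = v z.
  by rewrite /v cosD cosN sinN cos_pihalf sin_pihalf mul0r mulN1r opprK add0r.
have cos_le (x : R) : `|cos x| <= 1 by rewrite ler_norml cos_geN1 cos_le1.
have umul (f : R * R -> R) : T2integrable f -> T2integrable (fun z => u z * f z).
  move=> f1; apply: T2integrableM f1; first exact: T2measurable_cos.
  by move=> z; exact: cos_le.
have vmul (f : R * R -> R) : T2integrable f -> T2integrable (fun z => v z * f z).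
  move=> f1; apply: T2integrableM f1; first exact: T2measurable_cos.
  by move=> z; exact: cos_le.
move=> [r i]; split.
  under eq_fun do rewrite complexReM uE vE mulrC [CIm _ * _]mulrC -mulN1r.
  by apply: T2integrableD; [exact: umul|apply: T2integrableZ; exact: vmul].
under eq_fun do rewrite complexImM uE vE mulrC [CIm _ * _]mulrC.
by apply: T2integrableD; [exact: vmul|exact: umul].
Qed.

Lemma Cintegrable_cexp1 (m n : int) : Cintegrable (cexp m n).
Proof.
have := @Cintegrable_cexp m n _ (Cintegrable_cst 1).
by under eq_fun do rewrite mul1r.
Qed.

Lemma avg_cexp (m n : int) : avg (@cexp R m n) = ((m == 0) && (n == 0))%:R.
Proof.
rewrite avgE/= T2mean_sin.
have -> : T2mean (fun z => cos (m%:~R * z.1 + n%:~R * z.2)) =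
    ((m == 0) && (n == 0))%:R :> R.
  have := @T2mean_cos R 0 m n; rewrite cos0.
  by under [X in T2mean X]eq_fun do rewrite add0r; move=> ->; case: ifP.
by case: (_ && _).
Qed.

Lemma fcoef_cexp (p q m n : int) :
  fcoef (@cexp R p q) m n = ((p == m) && (q == n))%:R.
Proof.
rewrite /fcoef; under [X in avg X]eq_fun do rewrite cexpD.
by rewrite avg_cexp !subr_eq0.
Qed.

Section TrigPoly.
Variables (J : finType) (c : J -> R[i]) (a b : J -> int).

Definition trigPoly z := \sum_i c i * cexp (a i) (b i) z.

Lemma avg_mul_trigPoly g : Cintegrable g ->
  avg (fun z => g z * trigPoly z) = \sum_i c i * fcoef g (- a i) (- b i).
Proof.
move=> ig; rewrite /trigPoly.
under [X in avg X]eq_fun => z.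
  by rewrite mulr_sumr; under eq_bigr do rewrite mulrCA; over.
rewrite avg_sum => [|i]; last exact/CintegrableZ/Cintegrable_cexp.
apply: eq_bigr => i _; rewrite avgZ; last exact/Cintegrable_cexp.
by rewrite /fcoef !opprK.
Qed.

End TrigPoly.

Lemma cnorm2E w : (cnorm2 w)%:C = w * conjc w.
Proof.
case: w => x y; apply/eqP; rewrite eq_complex/= /cnorm2/=.
by apply/andP; split; apply/eqP; ring.
Qed.

Lemma cnorm2_ge0 w : 0 <= cnorm2 w.
Proof. by rewrite addr_ge0 ?sqr_ge0. Qed.

(** The squared modulus is again a trigonometric polynomial, indexed by pairs, so [avg_mul_trigPoly]
    applies to it. *)
Lemma cnorm2_trigPoly (J : finType) (c : J -> R[i]) (a b : J -> int) z :
  (cnorm2 (trigPoly c a b z))%:C =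
  trigPoly (fun p : J * J => c p.1 * conjc (c p.2))
    (fun p => a p.1 - a p.2) (fun p => b p.1 - b p.2) z.
Proof.
rewrite cnorm2E /trigPoly rmorph_sum big_distrlr pair_bigA.
apply: eq_bigr => p _; rewrite -cexpD -conj_cexp mulrACA.
by congr (_ * _); exact: (rmorphM (@conjc R)).
Qed.

(** The right-hand side is the Toeplitz form of [g]. Taking [g] to be 1, an exponential or a symbol
    yields in turn the norms, the Fejer coefficients and the Fejer means. *)
Lemma avg_mul_cnorm2 (J : finType) (c : J -> R[i]) (a b : J -> int) g :
  Cintegrable g ->
  avg (fun z => g z * (cnorm2 (trigPoly c a b z))%:C) =
  \sum_i \sum_j c i * conjc (c j) * fcoef g (a j - a i) (b j - b i).
Proof.
move=> ig; under [X in avg X]eq_fun do rewrite cnorm2_trigPoly.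
rewrite avg_mul_trigPoly// pair_bigA/=.
by apply: eq_bigr => p _; rewrite !opprB.
Qed.

Lemma T2mean_cnorm2 (J : finType) (c : J -> R[i]) (a b : J -> int) :
  (T2mean (fun z => cnorm2 (trigPoly c a b z)))%:C =
  \sum_i \sum_j c i * conjc (c j) * ((a i == a j) && (b i == b j))%:R.
Proof.
rewrite -avg_real.
have := avg_mul_cnorm2 c a b (Cintegrable_cst 1).
under [X in avg X]eq_fun do rewrite mul1r.
move=> ->; apply: eq_bigr => i _; apply: eq_bigr => j _; congr (_ * _).
have -> : (fun=> 1) = @cexp R 0 0 by apply/funext => z; rewrite cexp00.
have eqB (m n : int) : (0 == m - n) = (n == m) by rewrite eq_sym subr_eq0 eq_sym.
by rewrite fcoef_cexp !eqB.
Qed.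

Lemma anaPolyE N (c : nat -> nat -> R[i]) z : anaPoly N c z =
  trigPoly (fun p : 'I_N * 'I_N => c p.1 p.2)
    (fun p => (p.1 : nat)%:Z) (fun p => (p.2 : nat)%:Z) z.
Proof. by rewrite /anaPoly pair_bigA. Qed.

Lemma hankelCoefE g N (c : nat -> nat -> R[i]) (m n : int) : Cintegrable g ->
  hankelCoef g N c m n = \sum_(p : 'I_N * 'I_N)
    c p.1 p.2 * fcoef g (m - (p.1 : nat)%:Z) (n - (p.2 : nat)%:Z).
Proof.
move=> ig; rewrite /hankelCoef {1}/fcoef.
(* The exponential of [fcoef] is attached to [g] before the polynomial is expanded, so that only
   shifted coefficients of [g] appear. *)
under [X in avg X]eq_fun do rewrite anaPolyE mulrAC.
rewrite avg_mul_trigPoly; last exact: Cintegrable_cexp.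
apply: eq_bigr => p _; congr (_ * _); rewrite /fcoef.
congr avg; apply/funext => z.
by rewrite -mulrA cexpD !opprK !opprB ![- _ + _]addrC.
Qed.

(** Parseval: the frequencies are distinct, so only the diagonal pairs of [T2mean_cnorm2]
    survive. *)
Lemma L2norm2_anaPoly N (c : nat -> nat -> R[i]) :
  L2norm2 (anaPoly N c) = \sum_(p : 'I_N * 'I_N) cnorm2 (c p.1 p.2).
Proof.
apply: complexI.
have -> : L2norm2 (anaPoly N c) = T2mean (fun z => cnorm2 (anaPoly N c z)) by [].
under [X in T2mean X]eq_fun do rewrite anaPolyE.
rewrite T2mean_cnorm2 rmorph_sum/=; apply: eq_bigr => p _.
rewrite (bigD1 p)//= !eqxx mulr1 cnorm2E big1 ?addr0// => q qp.
rewrite !eqz_nat !val_eqE -[_ && _]/(p == q) eq_sym (negbTE qp).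
by rewrite mulr0.
Qed.

End ComplexMean.

(** * Schur test for Hilbert-type matrices *)

Section HilbertSchur.
Variable R : realType.

(* Telescoping: each term is at most an increment of
   4 / sqrt h * (sqrt x / (sqrt x + sqrt h)).  The term [x = 0] is the junk value [0]. *)
Lemma hilbert_sum_le (h : R) (X : nat) : 0 < h ->
  \sum_(x < X) ((x%:R + h) * Num.sqrt x%:R)^-1 <= 4 / Num.sqrt h.
Proof.
move=> h0; set s := Num.sqrt h.
have s0 : 0 < s by rewrite sqrtr_gt0.
have sE : s ^+ 2 = h by rewrite sqr_sqrtr// ltW.
have step (Y : nat) : \sum_(x < Y.+1) ((x%:R + h) * Num.sqrt x%:R)^-1 <=
    4 / s * (Num.sqrt Y%:R / (Num.sqrt Y%:R + s)).
  elim: Y => [|Y IHY].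
    by rewrite big_ord_recr big_ord0/= sqrtr0 !mulr0 mul0r mulr0 invr0 addr0.
  rewrite big_ord_recr/=; apply: le_trans (lerD IHY (lexx _)) _.
  set u := Num.sqrt Y%:R; set v := Num.sqrt Y.+1%:R.
  have u0 : 0 <= u by exact: sqrtr_ge0.
  have v0 : 0 < v by rewrite sqrtr_gt0 ltr0n.
  have uE : u ^+ 2 = Y%:R by rewrite sqr_sqrtr// ler0n.
  have vE : v ^+ 2 = Y.+1%:R by rewrite sqr_sqrtr// ler0n.
  have uv : u <= v by rewrite ler_sqrt ?ler0n// ler_nat.
  have uv1 : (v - u) * (u + v) = 1.
    transitivity (v ^+ 2 - u ^+ 2); first by ring.
    by rewrite uE vE -natr1; ring.
  have us : 0 < u + s by rewrite ltr_wpDl.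
  have vs : 0 < v + s by rewrite addr_gt0.
  rewrite -vE -sE -lerBrDl -mulrBr.
  have -> : 4 / s * (v / (v + s) - u / (u + s)) =
      4 / ((u + v) * (v + s) * (u + s)).
    have uv0 : 0 < u + v by rewrite ltr_wpDl.
    apply: (canRL (mulfK _)); first by rewrite !mulf_neq0// gt_eqF.
    transitivity (4 * ((v - u) * (u + v))); last by rewrite uv1 mulr1.
    by field; rewrite !gt_eqF.
  rewrite -[leLHS]mul1r ler_pdivrMr ?mulr_gt0 ?addr_gt0 ?exprn_gt0//.
  rewrite mulrAC ler_pdivlMr ?mulr_gt0// ?ltr_wpDl// mul1r.
  (* As [u <= v], the product [(u + v) (v + s) (u + s)] is at most [2 v (v + s)^2], hence by this
     inequality at most [4 v (v^2 + s^2)]: this is the origin of the constant 4. *)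
  have vs2 : (v + s) ^+ 2 <= 2 * (v ^+ 2 + s ^+ 2) by have := sqr_ge0 (v - s); nra.
  apply: (@le_trans _ _ ((v + v) * (v + s) * (v + s))).
    apply: ler_pM; rewrite ?mulr_ge0 ?addr_ge0 ?(ltW v0) ?(ltW s0)//; last by rewrite lerD2r.
    by rewrite ler_pM2r// lerD2r.
  rewrite (_ : _ * _ = (2 * v) * (v + s) ^+ 2); last by ring.
  rewrite (_ : 4 * _ = (2 * v) * (2 * (v ^+ 2 + s ^+ 2))); last by ring.
  by rewrite ler_pM2l// mulr_gt0.
case: X => [|X]; first by rewrite big_ord0 divr_ge0// ltW.
apply: le_trans (step X) _; rewrite ler_piMr ?divr_ge0 ?(ltW s0)//.
by rewrite ler_pdivrMr ?mul1r ?lerDl ?(ltW s0)// ltr_wpDl// sqrtr_ge0.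
Qed.

(** A list without repetitions lies inside an initial segment, and the extra terms are nonnegative.
    This bounds the column sums, which run over an arbitrary finite set of indices. *)
Lemma uniq_sum_le (F : nat -> R) (C : R) (s : seq nat) : (forall x, 0 <= F x) ->
  (forall X : nat, \sum_(x < X) F x <= C) -> uniq s -> \sum_(x <- s) F x <= C.
Proof.
move=> F0 FC us; pose X := (\max_(x <- s) x).+1.
apply: le_trans (FC X); rewrite -(big_mkord xpredT).
have -> : \sum_(x <- s) F x = \sum_(0 <= x < X | x \in s) F x.
  rewrite -[RHS]big_filter; apply: perm_big; apply: uniq_perm => //.
    by rewrite filter_uniq// iota_uniq.
  move=> x; rewrite mem_filter mem_index_iota/= ltnS andb_idr// => xs.
  by rewrite (big_rem x xs)/= leq_maxl.
by rewrite [leRHS](bigID (mem s))/= lerDl; apply: sumr_ge0.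
Qed.

(** Cauchy-Schwarz with weights [K p q * w q] in each row gives [rowC]; summing over the rows and
    exchanging the sums leaves the column bound. *)
Lemma schur_test (P : eqType) (Q : finType) (S : seq P) (K : P -> Q -> R)
    (c w : Q -> R) (v : P -> R) (A B : R) :
  0 < A -> (forall p q, 0 <= K p q) -> (forall q, 0 < w q) ->
  {in S, forall p, 0 < v p} ->
  {in S, forall p, \sum_q K p q * w q <= A * v p} ->
  (forall q, \sum_(p <- S) K p q * v p <= B * w q) ->
  \sum_(p <- S) (\sum_q K p q * c q) ^+ 2 <= A * B * \sum_q c q ^+ 2.
Proof.
move=> A0 K0 w0 v0 row col.
have rowC p : p \in S -> (\sum_q K p q * c q) ^+ 2 <=
    A * v p * \sum_q K p q * (c q ^+ 2 / w q).
  move=> pS; set T := \sum_q K p q * c q; set V := \sum_q _.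
  have Av0 : 0 < A * v p by rewrite mulr_gt0// v0.
  (* [x] minimizes [V - 2 x T + x^2 (A * v p)]; nonnegativity of this quadratic at its minimum is
     [T^2 <= A * v p * V]. *)
  pose x := T / (A * v p).
  have : 0 <= \sum_q K p q * w q * (c q / w q - x) ^+ 2.
    by apply: sumr_ge0 => q _; rewrite mulr_ge0 ?sqr_ge0// mulr_ge0// ltW.
  have -> : \sum_q K p q * w q * (c q / w q - x) ^+ 2 =
      V - 2 * x * T + x ^+ 2 * \sum_q K p q * w q.
    rewrite /V /T !mulr_sumr -sumrB -big_split/=; apply: eq_bigr => q _.
    by field; rewrite gt_eqF.
  move=> ge0; have {}ge0 : 0 <= V - 2 * x * T + x ^+ 2 * (A * v p).
    by apply: le_trans ge0 _; rewrite lerD2l ler_wpM2l ?sqr_ge0// row.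
  have xE : x * (A * v p) = T by rewrite divfK// gt_eqF.
  have : 0 <= (A * v p) * (V - 2 * x * T + x ^+ 2 * (A * v p)).
    by rewrite mulr_ge0// ltW.
  rewrite (_ : _ * _ = A * v p * V - 2 * (x * (A * v p)) * T +
    (x * (A * v p)) ^+ 2); last by ring.
  by rewrite xE; nra.
apply: (@le_trans _ _ (\sum_(p <- S) A * v p * \sum_q K p q * (c q ^+ 2 / w q))).
  by rewrite big_seq [leRHS]big_seq; apply: ler_sum.
rewrite (eq_bigr (fun p => \sum_q A * (c q ^+ 2 / w q) * (K p q * v p))); last first.
  by move=> p _; rewrite mulr_sumr; apply: eq_bigr => q _; ring.
rewrite exchange_big/= mulr_sumr; apply: ler_sum => q _.
rewrite -mulr_sumr; apply: (@le_trans _ _ (A * (c q ^+ 2 / w q) * (B * w q))).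
  by rewrite ler_wpM2l ?col// mulr_ge0 ?divr_ge0 ?sqr_ge0// ltW.
by rewrite le_eqVlt; apply/orP; left; apply/eqP; field; rewrite gt_eqF.
Qed.

Lemma cnorm2_normc (w : R[i]) : cnorm2 w = normc w ^+ 2.
Proof. by case: w => a b; rewrite /= sqr_sqrtr// addr_ge0 ?sqr_ge0. Qed.

Lemma normc_ge0 (w : R[i]) : 0 <= normc w.
Proof. by case: w => a b; exact: sqrtr_ge0. Qed.

Lemma normc_sum (J : Type) (s : seq J) (F : J -> R[i]) :
  normc (\sum_(i <- s) F i) <= \sum_(i <- s) normc (F i).
Proof.
elim: s => [|i s IHs]; first by rewrite !big_nil normc0.
by rewrite !big_cons; apply: le_trans (le_normcD _ _) _; rewrite lerD2l.
Qed.

(* The kernel is dominated by a Hilbert matrix on each line [j + l = m + n]; the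
   weights are the classical (l + 1) ^ -1/2 and |n| ^ -1/2. *)
Lemma hankel_half_le (kappa : int -> int -> R[i]) N (c : 'I_N * 'I_N -> R[i])
    (S : seq (int * int)) :
  (forall m n : int, m + n != 0 -> kappa m n = 0) ->
  (forall m n : int, n != 0 -> normc (kappa m n) <= 2 / `|n|%N%:R) ->
  uniq S -> {in S, forall p : int * int, p.2 < 0} ->
  \sum_(p <- S) cnorm2 (\sum_q c q *
      kappa (p.1 - (q.1 : nat)%:Z) (p.2 - (q.2 : nat)%:Z)) <=
  256 * \sum_q cnorm2 (c q).
Proof.
move=> kappa0 kappa_le uS Sneg.
(* On the support the second index has absolute value [l + |n|]. Since [|n| >= 1],
   [l + 1 + |n| <= 2 (l + |n|)], which turns the 2 of the hypothesis into 4 and keeps the weight at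
   [l + 1 > 0]. *)
pose K (p : int * int) (q : 'I_N * 'I_N) : R :=
  if p.1 + p.2 == ((q.1 + q.2)%N : int) then 4 / (q.2.+1%:R + `|p.2|%N%:R) else 0.
have K0 p q : 0 <= K p q by rewrite /K; case: ifP => // _; rewrite divr_ge0// addr_ge0.
have kappaK (p : int * int) (q : 'I_N * 'I_N) : p \in S ->
    normc (kappa (p.1 - (q.1 : nat)%:Z) (p.2 - (q.2 : nat)%:Z)) <= K p q.
  move=> pS; have p20 := Sneg p pS; rewrite /K; case: ifP => [pq|/eqP pq]; last first.
    by rewrite kappa0 ?normc0//; apply/eqP => h; apply: pq; lia.
  apply: le_trans (kappa_le _ _ _) _; first lia.
  have -> : `|p.2 - (q.2 : nat)%:Z|%N = (q.2 + `|p.2|)%N by lia.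
  have p21 : 1 <= `|p.2|%N%:R :> R by rewrite ler1n; lia.
  have q20 : 0 <= (q.2 : nat)%:R :> R by rewrite ler0n.
  rewrite natrD -natr1 ler_pdivrMr; last lra.
  rewrite mulrAC ler_pdivlMr; lra.
have E : 256 * \sum_q cnorm2 (c q) = 16 * 16 * \sum_q normc (c q) ^+ 2.
  congr (_ * _); first by rewrite -natrM.
  by apply: eq_bigr => q _; rewrite cnorm2_normc.
(* Both Schur constants are 16: the 4 in [K] times the 4 in [hilbert_sum_le]. *)
rewrite {}E; apply: le_trans (@schur_test _ _ S K (fun q => normc (c q))
  (fun q : 'I_N * 'I_N => (Num.sqrt q.2.+1%:R)^-1) (fun p => (Num.sqrt `|p.2|%N%:R)^-1)
  16 16 _ K0 _ _ _ _) => //.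
- rewrite big_seq [leRHS]big_seq; apply: ler_sum => p pS.
  rewrite cnorm2_normc ler_sqr ?nnegrE ?normc_ge0//; last first.
    by rewrite sumr_ge0// => q _; rewrite mulr_ge0 ?normc_ge0.
  apply: le_trans (normc_sum _ _) _; apply: ler_sum => q _.
  by rewrite normcM mulrC ler_wpM2r ?normc_ge0// kappaK.
- move=> -[m n] pS; rewrite invr_gt0 sqrtr_gt0 ltr0n absz_gt0/=.
  by have /= := Sneg _ pS; lia.
- move=> p pS; have h0 : 0 < `|p.2|%N%:R :> R.
    by rewrite ltr0n absz_gt0; case: p pS => m n /Sneg/=; lia.
  pose F (x : nat) : R := 4 * ((x%:R + `|p.2|%N%:R) * Num.sqrt x%:R)^-1.
  have F0 x : 0 <= F x.
    by rewrite mulr_ge0// invr_ge0 mulr_ge0 ?sqrtr_ge0// addr_ge0.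
  apply: (@le_trans _ _ (\sum_(l < N) F l.+1)).
    rewrite -(pair_bigA _ (fun j l => K p (j, l) * (Num.sqrt l.+1%:R)^-1))/=.
    rewrite exchange_big/=; apply: ler_sum => l _.
    (* For given [p] and [l] at most one [j] lies on the line, so the double sum collapses to a sum
       over [l]. *)
    have [[j jl]|nj] := pselect (exists j : 'I_N, p.1 + p.2 == ((j + l)%N : int)).
      rewrite (bigD1 j)//= big1 => [|i ij].
        by rewrite addr0 /K jl /F invfM mulrA.
      rewrite /K ifF ?mul0r//=; apply/negP => il; case/eqP: ij; apply: val_inj => /=.
      move: il; rewrite (eqP jl) eqz_nat eqn_add2r => /eqP <- //.
    rewrite big1 => [|i _]; first exact: F0.
    by rewrite /K ifF ?mul0r//; apply/negP => il; apply: nj; exists i.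
  (* The index-0 term of the Hilbert sum is 0; dropping it produces the shift [l.+1]. *)
  have := hilbert_sum_le N.+1 h0; rewrite big_ord_recl/=.
  rewrite sqrtr0 mulr0 invr0 add0r => h.
  rewrite -mulr_sumr; apply: le_trans (ler_wpM2l _ h) _ => //.
  by rewrite mulrA -natrM.
- move=> q; pose F (x : nat) : R := 4 * ((x%:R + q.2.+1%:R) * Num.sqrt x%:R)^-1.
  have F0 x : 0 <= F x.
    by rewrite mulr_ge0// invr_ge0 mulr_ge0 ?sqrtr_ge0// addr_ge0.
  rewrite (bigID (fun p => p.1 + p.2 == ((q.1 + q.2)%N : int)))/=.
  rewrite [X in _ + X]big1 => [|p /negbTE pq]; last by rewrite /K pq mul0r.
  rewrite addr0 (eq_bigr (fun p => F `|p.2|%N)); last first.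
    by move=> p pq; rewrite /K pq /F invfM mulrA [_%:R + _]addrC.
  rewrite -big_filter -(big_map (fun p : int * int => `|p.2|%N) xpredT F).
  apply: uniq_sum_le => //.
    move=> X; rewrite -mulr_sumr.
    apply: le_trans (ler_wpM2l _ (hilbert_sum_le X (ltr0Sn R q.2))) _ => //.
    by rewrite mulrA -natrM.
  (* On a fixed line [m + n = j + l] with [n < 0], the value [|n|] determines [(m, n)], so no value
     is repeated. *)
  rewrite map_inj_in_uniq ?filter_uniq// => -[m n] [m' n'].
  rewrite !mem_filter/= => /andP[/eqP e /Sneg/= n0] /andP[/eqP e' /Sneg/= n0'] nn'.
  by congr (_, _); lia.
Qed.

(** The indices with [n < 0] are covered by [hankel_half_le]. The others have [m < 0] by
    nonanalyticity, and exchanging the two coordinates brings them to the same case. *)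
Lemma hankel_le (kappa : int -> int -> R[i]) N (c : 'I_N * 'I_N -> R[i])
    (S : seq (int * int)) :
  (forall m n : int, m + n != 0 -> kappa m n = 0) ->
  (forall m n : int, n != 0 -> normc (kappa m n) <= 2 / `|n|%N%:R) ->
  uniq S -> all (fun p => nonanalytic p.1 p.2) S ->
  \sum_(p <- S) cnorm2 (\sum_q c q *
      kappa (p.1 - (q.1 : nat)%:Z) (p.2 - (q.2 : nat)%:Z)) <=
  512 * \sum_q cnorm2 (c q).
Proof.
move=> kappa0 kappa_le uS nS.
pose G (p : int * int) := cnorm2 (\sum_q c q *
  kappa (p.1 - (q.1 : nat)%:Z) (p.2 - (q.2 : nat)%:Z)).
rewrite -[leLHS]/(\sum_(p <- S) G p).
have G0 p : 0 <= G p by exact: cnorm2_ge0.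
rewrite (bigID (fun p : int * int => p.2 < 0))/=.
rewrite (_ : 512 = 256 + 256); last by rewrite -natrD.
rewrite mulrDl; apply: lerD.
  rewrite -big_filter; apply: hankel_half_le => //; first by rewrite filter_uniq.
  by move=> p; rewrite mem_filter => /andP[].
pose sw (T : Type) (p : T * T) := (p.2, p.1).
have swK (T : Type) : involutive (@sw T) by case.
have -> : \sum_q cnorm2 (c q) = \sum_q cnorm2 (c (sw _ q)).
  by rewrite (reindex_inj (inv_inj (@swK _))).
rewrite -big_filter; set S' := [seq p <- S | ~~ (p.2 < 0)].
have -> : \sum_(p <- S') G p = \sum_(p <- map (@sw _) S') cnorm2 (\sum_q c (sw _ q) *
    kappa (p.2 - (q.2 : nat)%:Z) (p.1 - (q.1 : nat)%:Z)).
  rewrite big_map; apply: eq_bigr => p _; congr cnorm2.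
  by rewrite (reindex_inj (inv_inj (@swK _))).
apply: (@hankel_half_le (fun m n => kappa n m)).
- by move=> m n mn; apply: kappa0; rewrite addrC.
(* The decay hypothesis is symmetric: [kappa] vanishes off the antidiagonal, and on it
   [|m| = |n|]. *)
- move=> m n n0; have [mn|mn] := eqVneq (m + n) 0; last first.
    by rewrite kappa0 ?normc0 ?divr_ge0// addrC.
  rewrite (_ : `|n|%N = `|m|%N); last lia.
  by apply: kappa_le; lia.
- by rewrite (map_inj_uniq (inv_inj (@swK _))) filter_uniq.
- move=> p /mapP[[m n]]; rewrite mem_filter => /andP[/= n0 mnS] ->/=.
  by move/allP : nS => /(_ _ mnS); rewrite /nonanalytic/= (negbTE n0) orbF.
Qed.

End HilbertSchur.

(** * Nonnegative series *)

Section NonnegSeries.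
Variable R : realType.
Implicit Type z : R * R.

Local Notation T2 := (@T2dom R).

Variable p : nat -> R * R -> R.
Hypothesis p_ge0 : forall n z, 0 <= p n z.
Hypothesis p_int : forall n, T2integrable (p n).

Definition nnseries z : \bar R := (\sum_(n <oo) (p n z)%:E)%E.

Lemma nnseries_ge0 z : (0 <= nnseries z)%E.
Proof. by apply: nneseries_ge0 => n _ _; rewrite lee_fin. Qed.

Lemma partial_le_nnseries K z : ((\sum_(n < K) p n z)%:E <= nnseries z)%E.
Proof.
rewrite -(big_mkord xpredT (fun n => p n z)) -sumEFin.
by apply: nneseries_lim_ge => n _ _; rewrite lee_fin.
Qed.

Lemma nnseries_cvg z : nnseries z \is a fin_num ->
  (fun K => \sum_(n < K) p n z) @ \oo --> fine (nnseries z).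
Proof.
move=> Ffin.
have : (fun K => \sum_(0 <= n < K) (p n z)%:E)%E @ \oo --> (fine (nnseries z))%:E.
  by rewrite fineK//; apply: is_cvg_nneseries => n _ _; rewrite lee_fin.
under eq_fun do rewrite sumEFin big_mkord.
by move=> /fine_cvgP[].
Qed.

Lemma measurable_nnseries : @measurable_fun _ _ (borel2 R) _ T2 nnseries.
Proof.
apply: ge0_emeasurable_sum => [k z _ _|k _]; first by rewrite lee_fin.
exact: measurable_int (p_int k).
Qed.

(** Sum and integral commute for nonnegative terms, and the bound on partial sums passes to the
    limit. *)
Lemma integral_nnseries_le (C : R) :
  (forall K, \sum_(n < K) T2mean (p n) <= C) ->
  (\int[@mu2 R]_(z in T2) nnseries z <= (C * (4 * pi ^+ 2))%:E)%E.
Proof.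
move=> pC.
have -> : (\int[@mu2 R]_(z in T2) nnseries z =
    \sum_(n <oo) \int[@mu2 R]_(z in T2) (p n z)%:E)%E.
  have mp n := measurable_int _ (p_int n).
  have pe_ge0 n z : T2 z -> (0 <= (EFin \o p n) z)%E by rewrite lee_fin.
  exact: (integral_nneseries (@mu2 R) (@measurable_T2dom R) mp pe_ge0).
apply: lime_le.
  by apply: is_cvg_nneseries => n _ _; apply: integral_ge0 => z _; rewrite lee_fin.
apply: nearW => K.
rewrite (eq_bigr (fun n => (T2mean (p n) * (4 * pi ^+ 2))%:E)); last first.
  by move=> n _; rewrite T2mean_EFin.
by rewrite sumEFin lee_fin -mulr_suml big_mkord ler_pM2r ?vol_gt0.
Qed.

Section Sum.
Variable C : R.
Hypothesis pC : forall K, \sum_(n < K) T2mean (p n) <= C.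

Lemma integrable_nnseries : (@mu2 R).-integrable T2 nnseries.
Proof.
apply/integrableP; split; first exact: measurable_nnseries.
under eq_integral do rewrite gee0_abs ?nnseries_ge0//.
exact: le_lt_trans (integral_nnseries_le pC) (ltry _).
Qed.

Definition nnsum z : R := fine (nnseries z).

Lemma nnsum_ge0 z : 0 <= nnsum z.
Proof. by rewrite fine_ge0// nnseries_ge0. Qed.

(** The two sides agree where the series converges; where it diverges, [fine] returns 0. *)
Lemma nnsum_le z : ((nnsum z)%:E <= nnseries z)%E.
Proof.
rewrite /nnsum; move: (nnseries_ge0 z); by case: (nnseries z).
Qed.

Lemma measurable_nnsum : @T2measurable R nnsum.
Proof.
apply: (measurableT_comp _ measurable_nnseries).
exact: fine_measurable.
Qed.

Lemma T2integrable_nnsum : T2integrable nnsum.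
Proof.
apply: (le_integrable (@measurable_T2dom R) _ _ integrable_nnseries).
  by apply/measurable_EFinP; exact: measurable_nnsum.
move=> z _; rewrite [leRHS]gee0_abs ?nnseries_ge0//.
by rewrite gee0_abs ?nnsum_le// lee_fin nnsum_ge0.
Qed.

Lemma T2mean_nnsum_le : T2mean nnsum <= C.
Proof.
rewrite -(ler_pM2r (@vol_gt0 R)) -lee_fin -T2mean_EFin; last exact: T2integrable_nnsum.
apply: le_trans (integral_nnseries_le pC).
apply: (ge0_le_integral _ (@measurable_T2dom R)).
- by move=> z _; rewrite lee_fin nnsum_ge0.
- by apply/measurable_EFinP; exact: measurable_nnsum.
- exact: measurable_nnseries.
- by move=> z _; exact: nnsum_le.
Qed.

(** The inequality can fail where the series diverges, since [nnsum] is 0 there; integrability makes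
    that set null. *)
Lemma partial_le_nnsum K :
  {ae (@mu2 R), forall z, T2 z -> \sum_(n < K) p n z <= nnsum z}.
Proof.
have [N [mN N0 FN]] := integrable_ae (@measurable_T2dom R) integrable_nnseries.
exists N; split => //; apply: subset_trans FN => z /=.
apply: contra_not => Ffin Tz.
by rewrite -lee_fin fineK ?partial_le_nnseries// Ffin.
Qed.

End Sum.
End NonnegSeries.

(** * Fejer kernels in x - y *)

Section Fejer.
Variable R : realType.
Implicit Type z : R * R.

Local Notation T2 := (@T2dom R).
Local Notation CRe := complex.Re.
Local Notation CIm := complex.Im.
Local Notation "x %:C" := (real_complex R x).

Definition dirichlet N : R * R -> R[i] :=
  trigPoly (fun _ : 'I_N => 1) (fun j => (j : nat)%:Z) (fun j => - (j : nat)%:Z).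

(** This is [N] times the usual Fejer kernel, evaluated at [x - y]. *)
Definition fejer N z : R := cnorm2 (dirichlet N z).

Lemma fejer_ge0 N z : 0 <= fejer N z.
Proof. exact: cnorm2_ge0. Qed.

Lemma normc_cexp (m n : int) z : normc (cexp m n z) = 1.
Proof. by rewrite /= cos2Dsin2 sqrtr1. Qed.

Lemma fejer_le N z : fejer N z <= N%:R ^+ 2.
Proof.
rewrite /fejer cnorm2_normc ler_sqr ?nnegrE ?normc_ge0 ?ler0n//.
apply: le_trans (normc_sum _ _) _.
rewrite (eq_bigr (fun=> 1)); first by rewrite big_const_ord iter_addr_0 lexx.
by move=> j _; rewrite mul1r normc_cexp.
Qed.

Lemma Cintegrable_trigPoly (J : finType) (c : J -> R[i]) (a b : J -> int) :
  Cintegrable (trigPoly c a b).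
Proof.
by apply: Cintegrable_sum => i; apply: CintegrableZ; exact: Cintegrable_cexp1.
Qed.

Lemma T2integrable_fejer N : T2integrable (fejer N).
Proof.
have -> : fejer N = fun z => CRe ((fejer N z)%:C) by [].
under eq_fun do rewrite /fejer /dirichlet cnorm2_trigPoly.
exact: (Cintegrable_trigPoly _ _ _).1.
Qed.

Lemma T2measurable_fejer N : T2measurable (fejer N).
Proof. by apply/measurable_EFinP; exact: measurable_int (T2integrable_fejer N). Qed.

Lemma T2integrable_fejerM N (f : R * R -> R) : T2integrable f ->
  T2integrable (fun z => f z * fejer N z).
Proof.
move=> f1; under eq_fun do rewrite mulrC.
apply: (T2integrableM (T2measurable_fejer N) _ f1) => z.
by rewrite ger0_norm ?fejer_ge0//; exact: fejer_le.
Qed.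

(** On the antidiagonal this is the triangular sequence [max(0, M - |n|)], kept as a count of pairs
    so that its bounds follow by counting. *)
Definition fejerCount M (m n : int) : nat :=
  (\sum_(i < M) \sum_(j < M) ((i%:Z == m + j%:Z)%R && (m + n == 0)%R))%N.

Lemma fcoef_fejer M (m n : int) :
  fcoef (fun z => (fejer M z)%:C) m n = (fejerCount M m n)%:R.
Proof.
rewrite /fcoef; under [X in avg X]eq_fun do rewrite mulrC.
rewrite avg_mul_cnorm2; last exact: Cintegrable_cexp1.
rewrite natr_sum; apply: eq_bigr => i _; rewrite natr_sum; apply: eq_bigr => j _.
rewrite conjc1 !mul1r fcoef_cexp; congr (_ %:R); congr nat_of_bool.
by apply/idP/idP; lia.
Qed.

Lemma fejerCount_diag M : fejerCount M 0 0 = M.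
Proof.
rewrite /fejerCount -[RHS](card_ord M) -sum1_card; apply: eq_bigr => i _.
rewrite (bigD1 i)//= add0r addr0 !eqxx/= big1 ?addn0// => j ji.
by rewrite add0r eqz_nat (inj_eq val_inj) eq_sym (negbTE ji).
Qed.

Lemma fejerCount_le M (m n : int) : (fejerCount M m n <= M)%N.
Proof.
rewrite -[leqRHS](card_ord M) -sum1_card; apply: leq_sum => i _.
have [[j ij]|nj] := pselect (exists j : 'I_M, i%:Z == m + j%:Z).
  rewrite (bigD1 j)//= big1 => [|k kj]; first by rewrite addn0 leq_b1.
  rewrite (_ : (_ == _) = false)//; apply/negP => ik; case/eqP: kj; apply: val_inj => /=.
  by lia.
rewrite big1// => j _; rewrite (_ : (_ == _) = false)//.
by apply/negP => ij; apply: nj; exists j.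
Qed.

Lemma fejerCount_eq0 M (m n : int) : m + n != 0 -> fejerCount M m n = 0%N.
Proof.
move=> /negbTE mn; rewrite /fejerCount big1// => i _; rewrite big1// => j _.
by rewrite mn andbF.
Qed.

Lemma fejerCount_large M (m n : int) : (M <= `|n|)%N -> fejerCount M m n = 0%N.
Proof.
move=> Mn; rewrite /fejerCount big1// => i _; rewrite big1// => j _.
by have := ltn_ord i; have := ltn_ord j; case: eqP => //= ?; case: eqP => //= ?; lia.
Qed.

Lemma T2mean_fejer N : T2mean (fejer N) = N%:R.
Proof.
apply: complexI; rewrite -avg_real.
have <- : fcoef (fun z => (fejer N z)%:C) 0 0 = avg (fun z => (fejer N z)%:C).
  by congr avg; apply/funext => z; rewrite oppr0 cexp00 mulr1.
by rewrite fcoef_fejer fejerCount_diag rmorph_nat.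
Qed.

Lemma avg_mul_fejer N (g : R * R -> R[i]) : Cintegrable g ->
  avg (fun z => g z * (fejer N z)%:C) =
  \sum_(i < N) \sum_(j < N) fcoef g (j%:Z - i%:Z) (i%:Z - j%:Z).
Proof.
move=> g1; rewrite avg_mul_cnorm2//.
apply: eq_bigr => i _; apply: eq_bigr => j _.
by rewrite conjc1 !mul1r opprK [- _ + _]addrC.
Qed.

(** The mean counts the solutions of [j - i = k - l] with [i, j < N] and [k, l < M]. Each of the
    [M^2] pairs [(k, l)] has at least the [N - M] solutions [i = t + l], [j = t + k] with
    [t < N - M]. *)
Lemma T2mean_fejer2_ge M N : (M <= N)%N ->
  (M%:R ^+ 2 * (N - M)%:R <= T2mean (fun z => fejer M z * fejer N z))%R.
Proof.
move=> MN; have M1 : Cintegrable (fun z => (fejer M z)%:C).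
  by split; [exact: T2integrable_fejer|exact: T2integrable_cst].
have -> : T2mean (fun z => fejer M z * fejer N z) =
    (\sum_(i < N) \sum_(j < N) fejerCount M (j%:Z - i%:Z) (i%:Z - j%:Z))%:R.
  apply: complexI; rewrite -avg_real.
  under [X in avg X]eq_fun do rewrite rmorphM.
  rewrite avg_mul_fejer// rmorph_nat natr_sum; apply: eq_bigr => i _.
  by rewrite natr_sum; apply: eq_bigr => j _; rewrite fcoef_fejer.
rewrite -natrX -natrM ler_nat.
under eq_bigr => i _.
  under eq_bigr => j _ do rewrite /fejerCount pair_bigA/=.
  by over.
rewrite pair_bigA/= exchange_big/=.
have -> : (M ^ 2 * (N - M) = \sum_(q : 'I_M * 'I_M) (N - M))%N.
  by rewrite sum_nat_const card_prod card_ord.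
apply: leq_sum => -[k l] _ /=.
have hlt (t : 'I_(N - M)) (r : 'I_M) : (t + r < N)%N.
  by have := ltn_ord t; have := ltn_ord r; lia.
pose h (t : 'I_(N - M)) : 'I_N * 'I_N := (Ordinal (hlt t l), Ordinal (hlt t k)).
have h_inj : injective h.
  by move=> t t' [/addIn tt' _]; exact: val_inj.
rewrite -[leqLHS]card_ord -(card_imset _ h_inj) -sum1_card [leqLHS]big_mkcond/=.
apply: leq_sum => q _; case: ifP => // /imsetP[t _ ->]/=.
by rewrite lt0b; apply/andP; split; apply/eqP; lia.
Qed.

End Fejer.

(** * The symbol *)

Section Symbol.
Variable R : realType.
Implicit Type z : R * R.

Local Notation T2 := (@T2dom R).
Local Notation CRe := complex.Re.
Local Notation CIm := complex.Im.
Local Notation "x %:C" := (real_complex R x).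

(** The factor [4^-n] brings the maximum, attained at [x = y], down to 1; the mean becomes [2^-n],
    which is summable. *)
Definition block (n : nat) z : R := (4 ^+ n)^-1 * fejer (2 ^ n) z.

Lemma expr4 (n : nat) : 4 ^+ n = 2 ^+ n * 2 ^+ n :> R.
Proof. by rewrite -exprMn -natrM. Qed.

Lemma block_ge0 n z : 0 <= block n z.
Proof. by rewrite mulr_ge0 ?fejer_ge0// invr_ge0 exprn_ge0. Qed.

Lemma block_le1 n z : block n z <= 1.
Proof.
rewrite /block mulrC ler_pdivrMr ?exprn_gt0// mul1r.
by apply: le_trans (fejer_le _ _) _; rewrite natrX expr2 expr4.
Qed.

Lemma T2integrable_block n : T2integrable (block n).
Proof. exact: (T2integrableZ (4 ^+ n)^-1 (T2integrable_fejer R (2 ^ n))). Qed.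

Lemma T2mean_block n : T2mean (block n) = 2 ^- n.
Proof.
rewrite [LHS](T2meanZ (4 ^+ n)^-1 (T2integrable_fejer R (2 ^ n))).
by rewrite T2mean_fejer natrX expr4 invfM divfK// expf_neq0.
Qed.

Lemma sum_T2mean_block K : \sum_(n < K) T2mean (block n) = 2 - 2 / 2 ^+ K.
Proof.
elim: K => [|K IHK]; first by rewrite big_ord0 expr0 divr1 subrr.
rewrite big_ord_recr/= IHK T2mean_block exprS.
by field; rewrite expf_neq0.
Qed.

Lemma sum_T2mean_block_le K : \sum_(n < K) T2mean (block n) <= 2.
Proof. by rewrite sum_T2mean_block gerDl oppr_le0 divr_ge0// exprn_ge0. Qed.

(* [nnsum] is [0] where the series diverges, a null set. *)
Definition phi0 : R * R -> R := nnsum block.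

Definition partial K z : R := \sum_(n < K) block n z.

Lemma T2integrable_phi0 : T2integrable phi0.
Proof.
exact: (T2integrable_nnsum block_ge0 T2integrable_block sum_T2mean_block_le).
Qed.

Lemma T2integrable_partial K : T2integrable (partial K).
Proof. by apply: T2integrable_sum => n; exact: T2integrable_block. Qed.

Lemma partial_le_phi0 K : {ae (@mu2 R), forall z, T2 z -> partial K z <= phi0 z}.
Proof.
exact: (partial_le_nnsum block_ge0 T2integrable_block sum_T2mean_block_le).
Qed.

(** The remainder is nonnegative almost everywhere, so this bound on its mean controls all its
    Fourier coefficients at once. *)
Lemma T2mean_phi0B K :
  T2mean (fun z => phi0 z + -1 * partial K z) <= 2 / 2 ^+ K.
Proof.
have iS := T2integrable_partial K.
rewrite T2meanD ?T2meanZ//; [|exact: T2integrable_phi0|exact: T2integrableZ].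
have -> : T2mean (partial K) = 2 - 2 / 2 ^+ K.
  by rewrite T2mean_sum ?sum_T2mean_block//; exact: T2integrable_block.
have := T2mean_nnsum_le block_ge0 T2integrable_block sum_T2mean_block_le.
rewrite -/phi0; lra.
Qed.

(* Since [partial K <= K] and [block K <= 1], passing from [partial K] to
   [partial K.+1] increases the square by at most [sqblock K]. *)
Definition sqblock (n : nat) z : R := (2 * n%:R + 1) * block n z.

Lemma sqblock_ge0 n z : 0 <= sqblock n z.
Proof. by rewrite mulr_ge0 ?block_ge0// addr_ge0// mulr_ge0. Qed.

Lemma T2integrable_sqblock n : T2integrable (sqblock n).
Proof. exact: (T2integrableZ (2 * n%:R + 1) (T2integrable_block n)). Qed.

Lemma sum_T2mean_sqblock_le K : \sum_(n < K) T2mean (sqblock n) <= 6.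
Proof.
(* The series of [(2 n + 1) / 2^n] sums to 6; the induction carries the exact remainder. *)
suff -> : \sum_(n < K) T2mean (sqblock n) = 6 - (4 * K%:R + 6) / 2 ^+ K.
  by rewrite gerDl oppr_le0 divr_ge0 ?exprn_ge0// addr_ge0// mulr_ge0.
elim: K => [|K IHK]; first by rewrite big_ord0 expr0 divr1; ring.
rewrite big_ord_recr/= IHK [T2mean (sqblock K)](T2meanZ _ (T2integrable_block K)).
rewrite T2mean_block exprS.
by rewrite -natr1; field; rewrite expf_neq0.
Qed.

Lemma partial_le K z : partial K z <= K%:R.
Proof.
rewrite /partial -[K in leRHS](card_ord K) -sum1_card natr_sum.
by apply: ler_sum => n _; exact: block_le1.
Qed.

Lemma partial_sqr_le K z : partial K z ^+ 2 <= \sum_(n < K) sqblock n z.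
Proof.
elim: K => [|K IHK]; first by rewrite /partial !big_ord0 expr0n.
rewrite /partial !big_ord_recr/= -/(partial K z) /sqblock.
have := partial_le K z; have := block_ge0 K z; have := block_le1 K z.
have K0 : 0 <= K%:R :> R by rewrite ler0n.
rewrite /sqblock in IHK; nra.
Qed.

(** Where the series converges, [phi0^2] is the limit of the squared partial sums, each bounded by
    [partial_sqr_le]; where it diverges, [phi0] is 0. Square integrability of the symbol follows. *)
Lemma phi0_sqr_le z : ((phi0 z ^+ 2)%:E <= nnseries sqblock z)%E.
Proof.
have Gge0 := nnseries_ge0 sqblock_ge0 z.
have [Ffin|Finf] := boolP (nnseries block z \is a fin_num); last first.
  rewrite /phi0 /nnsum; move: Finf (nnseries_ge0 block_ge0 z).
  by case: (nnseries block z) => //= _ _; rewrite expr0n.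
have cvS := nnseries_cvg block_ge0 Ffin.
have cvS2 : (fun K => (partial K z * partial K z)%:E) @ \oo --> (phi0 z * phi0 z)%:E.
  by apply: cvg_EFin; [exact: nearW|exact: cvgM].
rewrite expr2 -(cvg_lim _ cvS2)//.
apply: lime_le; first by apply/cvg_ex; eexists; exact: cvS2.
apply: nearW => K; apply: le_trans (partial_le_nnseries sqblock_ge0 K z).
by rewrite lee_fin -expr2 partial_sqr_le.
Qed.

Definition phi z : R[i] := (phi0 z)%:C.

Lemma cmeasurable_phi : cmeasurable phi.
Proof.
split; first exact: (measurable_nnsum block_ge0 T2integrable_block).
exact: measurable_cst.
Qed.

Lemma inL2_phi : inL2 phi.
Proof.
split; first exact: cmeasurable_phi.
apply: (@le_lt_trans _ _ (\int[@mu2 R]_(z in T2) nnseries sqblock z)%E); last first.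
  apply: le_lt_trans (ltry (6 * (4 * pi ^+ 2))).
  exact: (integral_nnseries_le sqblock_ge0 T2integrable_sqblock sum_T2mean_sqblock_le).
apply: (ge0_le_integral _ (@measurable_T2dom R)).
- by move=> z _; rewrite lee_fin cnorm2_ge0.
- have m0 := measurable_nnsum block_ge0 T2integrable_block.
  apply/measurable_EFinP.
  rewrite (_ : (fun z => cnorm2 (phi z)) = fun z => phi0 z * phi0 z).
    exact: measurable_funM.
  by apply/funext => z; rewrite /cnorm2/= expr0n addr0 expr2.
- exact: (measurable_nnseries sqblock_ge0 T2integrable_sqblock).
- by move=> z _; rewrite /cnorm2/= [0 ^+ 2]expr0n addr0 phi0_sqr_le.
Qed.

Lemma Cintegrable_phi : Cintegrable phi.
Proof. by split; [exact: T2integrable_phi0|exact: T2integrable_cst]. Qed.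

(** * Decay of the Fourier coefficients of the symbol *)

Lemma normc_le_ReIm (w : R[i]) : normc w <= `|CRe w| + `|CIm w|.
Proof.
case: w => a b /=; rewrite -(ler_sqr _ _) ?nnegrE ?sqrtr_ge0 ?addr_ge0//.
rewrite sqr_sqrtr ?addr_ge0 ?sqr_ge0// sqrrD !real_normK ?num_real//.
by rewrite -addrA lerD2l lerDr mulrn_wge0// mulr_ge0.
Qed.

Lemma T2mean_mul_le (h u : R * R -> R) : T2measurable u -> (forall z, `|u z| <= 1) ->
  T2integrable h -> {ae (@mu2 R), forall z, T2 z -> 0 <= h z} ->
  `|T2mean (fun z => u z * h z)| <= T2mean h.
Proof.
move=> mu u1 ih h0.
have iuh := T2integrableM mu u1 ih.
have [N [mN N0 hN]] := h0.
have ae (f g : R * R -> R) : (forall z, 0 <= h z -> f z <= g z) ->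
    {ae (@mu2 R), forall z, T2 z -> f z <= g z}.
  move=> fg; exists N; split => //; apply: subset_trans hN => z /=.
  by apply: contra_not => hz Tz; exact/fg/hz.
have uP z : -1 <= u z <= 1 by rewrite -ler_norml.
rewrite ler_norml; apply/andP; split.
  rewrite -mulN1r -T2meanZ//; apply: le_ae_T2mean => //; first exact: T2integrableZ.
  by apply: ae => z hz; rewrite ler_wpM2r//; case/andP: (uP z).
apply: le_ae_T2mean => //; apply: ae => z hz.
by rewrite -[leRHS]mul1r ler_wpM2r//; case/andP: (uP z).
Qed.

(** The real and the imaginary part are each at most the mean of [h]; hence the factor 2. *)
Lemma normc_fcoef_le (h : R * R -> R) (m n : int) : T2integrable h ->
  {ae (@mu2 R), forall z, T2 z -> 0 <= h z} ->
  normc (fcoef (fun z => (h z)%:C) m n) <= 2 * T2mean h.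
Proof.
move=> ih h0.
have cos_le (x : R) : `|cos x| <= 1 by rewrite ler_norml cos_geN1 cos_le1.
have mcos (a : R) := T2measurable_cos a (- m)%:~R (- n)%:~R.
apply: le_trans (normc_le_ReIm _) _; rewrite mulr_natl mulr2n /fcoef avgE.
apply: lerD.
  rewrite [leLHS](_ : _ = `|T2mean (fun z =>
      cos (0 + ((- m)%:~R * z.1 + (- n)%:~R * z.2)) * h z)|).
    by apply: T2mean_mul_le => // z; exact: cos_le.
  congr (`|T2mean _|); apply/funext => z.
  by rewrite complexReM/= mul0r subr0 add0r mulrC.
rewrite [leLHS](_ : _ = `|T2mean (fun z =>
    cos (- (pi / 2) + ((- m)%:~R * z.1 + (- n)%:~R * z.2)) * h z)|).
  by apply: T2mean_mul_le => // z; exact: cos_le.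
congr (`|T2mean _|); apply/funext => z.
rewrite complexImM/= mul0r addr0 mulrC; congr (_ * _).
by rewrite [RHS]cosD cosN sinN cos_pihalf sin_pihalf mul0r mulN1r opprK add0r.
Qed.

Lemma fcoef_partial K (m n : int) :
  fcoef (fun z => (partial K z)%:C) m n =
  (\sum_(k < K) (4 ^+ k)^-1 * (fejerCount (2 ^ k) m n)%:R)%:C.
Proof.
rewrite /fcoef rmorph_sum/=.
under [X in avg X]eq_fun do rewrite /partial rmorph_sum mulr_suml.
have fC k : Cintegrable (fun z => (fejer k z)%:C).
  by split; [exact: T2integrable_fejer|exact: T2integrable_cst].
rewrite (avg_sum _ (G := fun (k : 'I_K) z => (block k z)%:C * cexp (- m) (- n) z)).
  apply: eq_bigr => k _; rewrite rmorphM rmorph_nat -fcoef_fejer /fcoef -avgZ.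
    by congr avg; apply/funext => z; rewrite rmorphM mulrA.
  exact: Cintegrable_cexp.
move=> k; apply: Cintegrable_cexp.
by split; [exact: T2integrable_block|exact: T2integrable_cst].
Qed.

Lemma tail_sum_le K (x : nat) : (0 < x)%N ->
  \sum_(k < K) (if (x < 2 ^ k)%N then 2 ^- k else 0) <= 2 / x%:R :> R.
Proof.
move=> x0; have xR : 0 < x%:R :> R by rewrite ltr0n.
(* Strengthened for the induction by the geometric remainder [2 / 2^K]; the maximum with 0 covers
   the initial range, where this difference is negative and the sum is empty of nonzero terms. *)
suff h : \sum_(k < K) (if (x < 2 ^ k)%N then 2 ^- k else 0) <=
    Num.max 0 (2 / x%:R - 2 / 2 ^+ K) :> R.
  apply: le_trans h _; rewrite ge_max divr_ge0 ?ler0n//=.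
  by rewrite gerDl oppr_le0 divr_ge0// exprn_ge0.
elim: K => [|K IHK]; first by rewrite big_ord0 le_max lexx.
have e0 : 0 < 2 ^+ K :> R by rewrite exprn_gt0.
have eS : 2 / 2 ^+ K.+1 = 2 ^- K :> R by rewrite exprS invfM mulVKf.
rewrite big_ord_recr/= eS; case: ifP => xK; last first.
  rewrite addr0; apply: le_trans IHK _; rewrite ge_max le_max lexx/= le_max.
  apply/orP; right; rewrite lerD2l lerN2 ler_peMl ?invr_ge0 ?(ltW e0)//.
  by rewrite ler1n.
have xKR : x%:R <= 2 ^+ K :> R by rewrite -natrX ler_nat ltnW.
have le1 : 2 / 2 ^+ K <= 2 / x%:R :> R.
  by rewrite ler_wpM2l// lef_pV2 ?posrE.
rewrite max_r ?subr_ge0// in IHK.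
rewrite le_max; apply/orP; right; lra.
Qed.

(** Only blocks with [2^k > |n|] have a nonzero coefficient, and each contributes at most
    [4^-k 2^k = 2^-k]; [tail_sum_le] adds these up. *)
Lemma normc_fcoef_partial K (m n : int) : n != 0 ->
  normc (fcoef (fun z => (partial K z)%:C) m n) <= 2 / `|n|%N%:R.
Proof.
move=> n0; rewrite fcoef_partial /= expr0n addr0 sqrtr_sqr ger0_norm; last first.
  by apply: sumr_ge0 => k _; rewrite mulr_ge0// invr_ge0 exprn_ge0.
apply: le_trans (tail_sum_le K _); last by rewrite absz_gt0.
apply: ler_sum => k _; case: ifPn => [_|]; last first.
  by rewrite -leqNgt => kn; rewrite fejerCount_large// mulr0.
rewrite mulrC ler_pdivrMr ?exprn_gt0// expr4 mulKf ?expf_neq0//.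
by rewrite -natrX ler_nat fejerCount_le.
Qed.

Lemma fcoef_partial_eq0 K (m n : int) : m + n != 0 ->
  fcoef (fun z => (partial K z)%:C) m n = 0.
Proof.
by move=> mn; rewrite fcoef_partial big1// => k _; rewrite fejerCount_eq0// mulr0.
Qed.

(** Split the symbol into [partial K] and a remainder. The 4 is the 2 of [normc_fcoef_le] times the
    2 of [T2mean_phi0B]; letting [K] grow carries the estimates for [partial] over to [phi]. *)
Lemma normc_fcoef_phi_le (m n : int) K :
  normc (fcoef phi m n) <=
  normc (fcoef (fun z => (partial K z)%:C) m n) + 4 / 2 ^+ K.
Proof.
pose h z := phi0 z + -1 * partial K z.
have iP := T2integrable_partial K.
have ih : T2integrable h.
  by apply: T2integrableD; [exact: T2integrable_phi0|exact: T2integrableZ].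
have h0 : {ae (@mu2 R), forall z, T2 z -> 0 <= h z}.
  have [N [mN N0 hN]] := partial_le_phi0 K; exists N; split => //.
  apply: subset_trans hN => z /=; apply: contra_not => hz Tz.
  by rewrite /h mulN1r subr_ge0 hz.
have -> : fcoef phi m n =
    fcoef (fun z => (partial K z)%:C) m n + fcoef (fun z => (h z)%:C) m n.
  rewrite /fcoef -avgD.
  - congr avg; apply/funext => z; rewrite -mulrDl -rmorphD /h.
    by rewrite mulN1r addrCA subrr addr0.
  - by apply: Cintegrable_cexp; split; [|exact: T2integrable_cst].
  - by apply: Cintegrable_cexp; split; [|exact: T2integrable_cst].
apply: le_trans (le_normcD _ _) _; rewrite lerD2l.
apply: le_trans (normc_fcoef_le m n ih h0) _.
have := T2mean_phi0B K; rewrite -/h => hK.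
apply: le_trans (ler_wpM2l _ hK) _ => //.
by rewrite mulrA -natrM.
Qed.

Lemma le_of_geometric (x y : R) : (forall K, x <= y + 4 / 2 ^+ K) -> x <= y.
Proof.
move=> h; apply/ler_addgt0Pr => e e0.
pose K := Num.Def.archi_bound (4 / e).
have hK : 4 / e < 2 ^+ K by exact: upper_nthrootP.
apply: le_trans (h K) _; rewrite lerD2l ler_pdivrMr ?exprn_gt0//.
by rewrite mulrC -ler_pdivrMr// ltW.
Qed.

Lemma fcoef_phi_eq0 (m n : int) : m + n != 0 -> fcoef phi m n = 0.
Proof.
move=> mn; apply: eq0_normc; apply/eqP; rewrite eq_le normc_ge0 andbT.
apply: le_of_geometric => K; apply: le_trans (normc_fcoef_phi_le m n K) _.
by rewrite fcoef_partial_eq0// normc0.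
Qed.

Lemma fcoef_phi_le (m n : int) : n != 0 -> normc (fcoef phi m n) <= 2 / `|n|%N%:R.
Proof.
move=> n0; apply: le_of_geometric => K.
apply: le_trans (normc_fcoef_phi_le m n K) _.
by rewrite lerD2r; exact: normc_fcoef_partial.
Qed.

Lemma bounded_hankel_phi : bounded_hankel phi.
Proof.
exists 512 => N c S uS nS; rewrite L2norm2_anaPoly.
under eq_bigr => p _ do rewrite (hankelCoefE _ _ _ _ Cintegrable_phi).
exact: (hankel_le (fun q : 'I_N * 'I_N => c q.1 q.2)
  fcoef_phi_eq0 fcoef_phi_le uS nS).
Qed.

(** By [T2mean_fejer2_ge], each block with [n < K] contributes at least [2^K - 2^n], and these add
    up to [K 2^K - (2^K - 1)]. *)
Lemma T2mean_phi0_fejer_ge K :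
  (K%:R - 1) * 2 ^+ K <= T2mean (fun z => phi0 z * fejer (2 ^ K) z).
Proof.
apply: (@le_trans _ _ (T2mean (fun z => partial K z * fejer (2 ^ K) z))); last first.
  apply: le_ae_T2mean.
  - exact/T2integrable_fejerM/T2integrable_partial.
  - exact/T2integrable_fejerM/T2integrable_phi0.
  - have [N [mN N0 hN]] := partial_le_phi0 K; exists N; split => //.
    apply: subset_trans hN => z /=; apply: contra_not => hz Tz.
    by rewrite ler_wpM2r ?fejer_ge0// hz.
have fS z : partial K z * fejer (2 ^ K) z =
    \sum_(n < K) (4 ^+ n)^-1 * (fejer (2 ^ n) z * fejer (2 ^ K) z).
  by rewrite mulr_suml; apply: eq_bigr => n _; rewrite mulrA.
have iff M N : T2integrable (fun z => fejer M z * fejer N z).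
  exact/T2integrable_fejerM/T2integrable_fejer.
under [X in T2mean X]eq_fun do rewrite fS.
rewrite (T2mean_sum _ (F := fun (n : 'I_K) z =>
  (4 ^+ n)^-1 * (fejer (2 ^ n) z * fejer (2 ^ K) z))); last first.
  by move=> n; exact: T2integrableZ.
apply: (@le_trans _ _ (\sum_(n < K) (2 ^+ K - 2 ^+ n))).
  rewrite sumrB sumr_const card_ord -mulr_natl.
  have -> : \sum_(n < K) 2 ^+ n = 2 ^+ K - 1 :> R by rewrite subrX1; ring.
  lra.
apply: ler_sum => n _; rewrite T2meanZ//.
rewrite -[leLHS](@mulKf _ (4 ^+ n)) ?expf_neq0//.
rewrite ler_wpM2l ?invr_ge0 ?exprn_ge0//.
have nK : (2 ^ n <= 2 ^ K)%N by rewrite leq_exp2l// ltnW.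
by have := T2mean_fejer2_ge R nK; rewrite natrB// !natrX expr2 -expr4.
Qed.

(** * Bounded symbols tested against Fejer kernels *)

Section BoundedSymbol.
Variables (psi : R * R -> R[i]) (M : R).
Hypothesis psi_meas : cmeasurable psi.
Hypothesis psi_le : {ae (@mu2 R), forall z, T2 z -> cabs (psi z) <= M}.

Lemma T2integrable_ae_bounded (f : R * R -> R) : T2measurable f ->
  {ae (@mu2 R), forall z, T2 z -> `|f z| <= M} -> T2integrable f.
Proof.
move=> mf fM; apply/integrableP; split; first exact/measurable_EFinP.
have mabs : @measurable_fun _ _ (borel2 R) _ T2 (fun z => `|(f z)%:E|%E).
  by apply: measurableT_comp => //; exact/measurable_EFinP.
(* The dominating constant is [|M|] because [M] carries no sign assumption. *)
apply: (@le_lt_trans _ _ (\int[@mu2 R]_(z in T2) (cst `|M|%:E) z)%E); last first.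
  by rewrite integral_cst ?lte_mul_pinfty ?mu2_T2dom_lty//; exact: measurable_T2dom.
have [N [mN N0 hN]] := fM.
have mcst := @measurable_cst _ _ (borel2 R) _ T2 (`|M|%:E).
apply: (ae_ge0_le_integral (@measurable_T2dom R) _ mabs _ mcst) => //.
  by move=> z _; rewrite lee_fin.
exists N; split => //; apply: subset_trans hN => z /=; apply: contra_not => fz Tz.
by rewrite lee_fin (le_trans (fz Tz))// ler_norm.
Qed.

Lemma Re_le_cabs (w : R[i]) : `|CRe w| <= cabs w.
Proof.
by rewrite -sqrtr_sqr ler_sqrt ?cnorm2_ge0// lerDl sqr_ge0.
Qed.

Lemma Im_le_cabs (w : R[i]) : `|CIm w| <= cabs w.
Proof.
by rewrite -sqrtr_sqr ler_sqrt ?cnorm2_ge0// lerDr sqr_ge0.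
Qed.

Lemma ae_le_cabs (f : R * R -> R) : (forall z, `|f z| <= cabs (psi z)) ->
  {ae (@mu2 R), forall z, T2 z -> `|f z| <= M}.
Proof.
move=> fpsi; have [N [mN N0 hN]] := psi_le; exists N; split => //.
apply: subset_trans hN => z /=; apply: contra_not => hz Tz.
exact: le_trans (fpsi z) (hz Tz).
Qed.

Lemma Cintegrable_bounded : Cintegrable psi.
Proof.
by case: psi_meas => mr mi; split; apply: T2integrable_ae_bounded => //;
  apply: ae_le_cabs => z; [exact: Re_le_cabs|exact: Im_le_cabs].
Qed.

Lemma T2mean_bounded_fejer N :
  T2mean (fun z => CRe (psi z) * fejer N z) <= M * N%:R.
Proof.
rewrite -T2mean_fejer -T2meanZ; last exact: T2integrable_fejer.
apply: le_ae_T2mean.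
- exact/T2integrable_fejerM/Cintegrable_bounded.1.
- exact: T2integrableZ (T2integrable_fejer R _).
- have [E [mE E0 hE]] := ae_le_cabs (fun z => Re_le_cabs (psi z)).
  exists E; split => //; apply: subset_trans hE => z /=; apply: contra_not => hz Tz.
  by rewrite ler_wpM2r ?fejer_ge0// (le_trans (ler_norm _))// hz.
Qed.

End BoundedSymbol.

(** Applying the operator to the constant 1 reads off the nonanalytic Fourier coefficients of a
    symbol, so two symbols of one operator share them. *)
Lemma hankelCoef1 (g : R * R -> R[i]) (m n : int) :
  hankelCoef g 1 (fun _ _ => 1) m n = fcoef g m n.
Proof.
rewrite /hankelCoef; congr (fcoef _ m n); apply/funext => z.
by rewrite /anaPoly !big_ord1 mul1r cexp00 mulr1.
Qed.

(** The Fejer mean involves only the coefficients at [(j - i, i - j)]. For [i != j] one entry is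
    negative and the symbols agree; the [N] diagonal terms each contribute the discrepancy at
    [(0, 0)]. *)
Lemma avg_fejer_eq (g1 g2 : R * R -> R[i]) N :
  Cintegrable g1 -> Cintegrable g2 -> same_hankel g1 g2 ->
  avg (fun z => g1 z * (fejer N z)%:C) =
  avg (fun z => g2 z * (fejer N z)%:C) + (fcoef g1 0 0 - fcoef g2 0 0) *+ N.
Proof.
move=> i1 i2 same; rewrite !avg_mul_fejer//.
have -> : (fcoef g1 0 0 - fcoef g2 0 0) *+ N =
    \sum_(i < N) (fcoef g1 0 0 - fcoef g2 0 0) by rewrite sumr_const card_ord.
rewrite -big_split/=; apply: eq_bigr => i _.
rewrite [LHS](bigD1 i)//= [X in _ = X + _](bigD1 i)//= !subrr.
rewrite addrAC [fcoef g2 0 0 + _]addrC subrK; congr (_ + _).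
apply: eq_bigr => j ji; rewrite -!hankelCoef1 same// /nonanalytic.
have {ji} : (j != i :> nat) by [].
by move: (nat_of_ord i) (nat_of_ord j) => a b; lia.
Qed.

Lemma no_bounded_symbol (psi : R * R -> R[i]) :
  inLinf psi -> same_hankel psi phi -> False.
Proof.
move=> [mpsi [M psiM]] same.
have ipsi := Cintegrable_bounded mpsi psiM.
pose B := CRe (fcoef psi 0 0 - fcoef phi 0 0).
(* Dividing the comparison of Fejer means by [2^K] gives this bound for every [K], with [B]
   independent of [K], which contradicts the Archimedean property. *)
suff KM K : K%:R - 1 <= M - B.
  have lt_abs : M - B + 1 < (Num.Def.archi_bound `|M - B + 1|)%:R.
    exact: le_lt_trans (ler_norm _) (archi_boundP (normr_ge0 _)).
  by have := KM (Num.Def.archi_bound `|M - B + 1|); lra.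
have e0 : 0 < 2 ^+ K :> R by rewrite exprn_gt0.
rewrite -(ler_pM2r e0).
have := avg_fejer_eq (2 ^ K) ipsi Cintegrable_phi same.
move/(congr1 (@complex.Re R)); rewrite complexReD.
have ReMr (w : R[i]) (x : R) : CRe (w * x%:C) = CRe w * x.
  by rewrite complexReM/= mulr0 subr0.
have -> : CRe (avg (fun z => psi z * (fejer (2 ^ K) z)%:C)) =
    T2mean (fun z => CRe (psi z) * fejer (2 ^ K) z).
  by rewrite avgE; congr T2mean; apply/funext => z; rewrite ReMr.
have -> : CRe (avg (fun z => phi z * (fejer (2 ^ K) z)%:C)) =
    T2mean (fun z => phi0 z * fejer (2 ^ K) z).
  by rewrite avgE; congr T2mean; apply/funext => z; rewrite ReMr.
have -> : CRe ((fcoef psi 0 0 - fcoef phi 0 0) *+ 2 ^ K) = B * 2 ^+ K.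
  have -> : CRe ((fcoef psi 0 0 - fcoef phi 0 0) *+ 2 ^ K) =
      CRe ((fcoef psi 0 0 - fcoef phi 0 0) * (2 ^+ K)%:C).
    by rewrite -natrX rmorph_nat mulr_natr.
  by rewrite ReMr.
have := T2mean_bounded_fejer mpsi psiM (2 ^ K); rewrite natrX.
have := T2mean_phi0_fejer_ge K; lra.
Qed.

End Symbol.

Theorem theorem2p1 (R : realType) :
  exists phi : R * R -> R[i],
    inL2 phi /\ bounded_hankel phi /\
    ~ (exists psi : R * R -> R[i], inLinf psi /\ same_hankel psi phi).
Proof.
exists (@phi R); split; first exact: inL2_phi.
split; first exact: bounded_hankel_phi.
by case=> psi [psi_inf same]; exact: no_bounded_symbol psi_inf same.
Qed.
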